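(* Let $\mathbb{F}$ be an infinite field of arbitrary characteristic, let $\mathsf{A}_1$ be the Weyl algebra over $\mathbb{F}$ with generators $x,y$, and let $\mathsf{V}=\mathbb{F}\text{-}\mathrm{span}\{x,y\}\subset\mathsf{A}_1$. Every weak polynomial identity $f\in\mathbb{F}\langle x_1,x_2\rangle$ for the pair $(\mathsf{A}_1,\mathsf{V})$ in two variables lies in the L-ideal $\mathcal{I}$ of $\mathbb{F}\langle X\rangle$ generated by $\mathrm{St}_3$, $\Gamma_3$, $T_4$.
   Context: The Weyl algebra is the unital associative algebra $\mathsf{A}_1=\mathbb{F}\langle x,y\rangle/(yx-xy-1)$. $\mathbb{F}\langle X\rangle$ is the free unital associative $\mathbb{F}$-algebra on free generators $x_1,x_2,\ldots$, and $\mathbb{F}\langle x_1,x_2\rangle$ is its subalgebra generated by $x_1,x_2$. A weak polynomial identity for the pair $(\mathsf{A}_1,\mathsf{V})$ is an element $f(x_1,\ldots,x_m)\in\mathbb{F}\langle X\rangle$ such that $f(v_1,\ldots,v_m)=0$ in $\mathsf{A}_1$ for all $v_1,\ldots,v_m\in\mathsf{V}$. With $[a,b]=ab-ba$, put $$\Gamma_3(x_1,x_2,x_3)=[[x_1,x_2],x_3],\qquad \mathrm{St}_3(x_1,x_2,x_3)=x_1[x_2,x_3]-x_2[x_1,x_3]+x_3[x_1,x_2],$$ $$T_4(x_1,x_2,x_3,x_4)=[x_1,x_2][x_3,x_4]-[x_1,x_3][x_2,x_4]+[x_2,x_3][x_1,x_4].$$ The L-ideal generated by $f_1,\ldots,f_k\in\mathbb{F}\langle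 X\rangle$ is the $\mathbb{F}$-span of all $f^{(1)}f_i(g_1,\ldots,g_m)f^{(2)}$ with $f^{(1)},f^{(2)}\in\mathbb{F}\langle X\rangle$, $g_1,\ldots,g_m$ linear combinations of letters $x_1,x_2,\ldots$, and $1\le i\le k$. Thus $\mathcal{I}$ is the two-sided ideal of $\mathbb{F}\langle X\rangle$ generated by $\Gamma_3(x_i,x_j,x_k)$, $\mathrm{St}_3(x_i,x_j,x_k)$, $T_4(x_i,x_j,x_k,x_l)$ for all $i,j,k,l>0$. *)

(* Defs.v *)
From HB Require Import structures.
From mathcomp Require Import all_boot all_order all_algebra.
From mathcomp Require Import generic_quotient ring_quotient.
From mathcomp Require Import finmap monalg.
From mathcomp Require Import boolp classical_sets cardinality.

Set Implicit Arguments.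
Unset Strict Implicit.
Unset Printing Implicit Defensive.

Import GRing.Theory.

Local Open Scope ring_scope.
Local Open Scope classical_set_scope.
Local Open Scope quotient_scope.

Section Generation.
Variables (F : fieldType) (A : algType F).
Implicit Types S : set A.

Definition lspan S : set A :=
  [set f | exists s : seq (F * A),
     (forall t, t \in s -> S t.2) /\ f = \sum_(t <- s) t.1 *: t.2].

Definition ideal_gen S : set A :=
  lspan [set h | exists a r b, S r /\ h = a * r * b].

Inductive subalg_gen S : set A :=
| subalg_gen_base a of S a : subalg_gen S a
| subalg_gen1 : subalg_gen S 1
| subalg_genD a b of subalg_gen S a & subalg_gen S b : subalg_gen S (a + b)
| subalg_genZ c a of subalg_gen S a : subalg_gen S (c *: a)
| subalg_genM a b of subalg_gen S a & subalg_gen S b : subalg_gen S (a * b).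

Lemma lspan0 S : lspan S 0.
Proof. by exists [::]; rewrite big_nil. Qed.

Lemma lspanD S f g : lspan S f -> lspan S g -> lspan S (f + g).
Proof.
move=> [s [Ss ->]] [t [St ->]]; exists (s ++ t); rewrite big_cat; split=> // u.
by rewrite mem_cat => /orP[/Ss|/St].
Qed.

Lemma lspanZ S c f : lspan S f -> lspan S (c *: f).
Proof.
move=> [s [Ss ->]]; exists [seq (c * t.1, t.2) | t <- s]; split.
  by move=> _ /mapP[t /Ss St ->].
by rewrite big_map scaler_sumr; apply: eq_bigr => t _; rewrite scalerA.
Qed.

Lemma ideal_genMl S a f : ideal_gen S f -> ideal_gen S (a * f).
Proof.
move=> [s [Ss ->]]; exists [seq (t.1, a * t.2) | t <- s]; split.
  move=> _ /mapP[t /Ss [b [r [c [Sr ->]]]] ->] /=.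
  by exists (a * b), r, c; rewrite !mulrA.
by rewrite big_map mulr_sumr; apply: eq_bigr => t _; rewrite scalerAr.
Qed.

Lemma ideal_genMr S a f : ideal_gen S f -> ideal_gen S (f * a).
Proof.
move=> [s [Ss ->]]; exists [seq (t.1, t.2 * a) | t <- s]; split.
  move=> _ /mapP[t /Ss [b [r [c [Sr ->]]]] ->] /=.
  by exists b, r, (c * a); rewrite !mulrA.
by rewrite big_map mulr_suml; apply: eq_bigr => t _; rewrite scalerAl.
Qed.

End Generation.

Section AlgebraQuotient.
Variables (F : fieldType) (A : algType F) (S : set A).

Definition idealb : {pred A} := fun f => `[< ideal_gen S f >].

Fact idealb_zmod_closed : zmod_closed idealb.
Proof.
split=> [|f g /asboolP If /asboolP Ig]; apply/asboolP; first exact: lspan0.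
by apply: lspanD If _; rewrite -[- g]scaleN1r; apply: lspanZ.
Qed.

HB.instance Definition _ := GRing.isZmodClosed.Build A idealb idealb_zmod_closed.

Fact idealbMl a f : f \in idealb -> a * f \in idealb.
Proof. by move=> /asboolP If; apply/asboolP/ideal_genMl. Qed.

Fact idealbMr a f : f \in idealb -> f * a \in idealb.
Proof. by move=> /asboolP If; apply/asboolP/ideal_genMr. Qed.

Fact idealbZ c f : f \in idealb -> c *: f \in idealb.
Proof. by move=> /asboolP If; apply/asboolP/lspanZ. Qed.

(* MathComp algebras are nontrivial, hence the properness hypothesis. *)
Hypothesis S_proper : ~ ideal_gen S 1.

Definition alg_quot := let _ := S_proper in {ideal_quot idealb}.

HB.instance Definition _ := EqQuotient.on alg_quot.
HB.instance Definition _ := GRing.Zmodule.on alg_quot.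

Local Notation pi := (\pi_alg_quot : A -> alg_quot).

Let qone : alg_quot := pi 1.
Let qmul (a b : alg_quot) : alg_quot := pi (repr a * repr b).
Let qscale (c : F) (a : alg_quot) : alg_quot := pi (c *: repr a).

Fact pi_quot_eq f g : (pi f = pi g) <-> (f - g \in idealb).
Proof. by rewrite Quotient.idealrBE; split=> [->|/eqP]. Qed.

Let repr_pi f : repr (pi f) - f \in idealb.
Proof. by apply/pi_quot_eq; rewrite reprK. Qed.

Let pi_qmul f g : pi (f * g) = qmul (pi f) (pi g).
Proof.
apply/esym/pi_quot_eq; rewrite -(subrKA (f * repr (pi g))) -mulrBl -mulrBr.
by apply: rpredD; [apply: idealbMr | apply: idealbMl].
Qed.

Let pi_qscale c f : pi (c *: f) = qscale c (pi f).
Proof. by apply/esym/pi_quot_eq; rewrite -scalerBr idealbZ. Qed.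

Let quotP (P : alg_quot -> Prop) : (forall f, P (pi f)) -> forall a, P a.
Proof. by move=> Ppi a; rewrite -[a]reprK. Qed.

Let piD f g : pi (f + g) = pi f + pi g. Proof. exact: raddfD. Qed.

Fact qmulA : associative qmul.
Proof.
by do 3![elim/quotP=> ?]; rewrite -!pi_qmul mulrA.
Qed.

Fact qmul1r : left_id qone qmul.
Proof. by elim/quotP=> f; rewrite -pi_qmul mul1r. Qed.

Fact qmulr1 : right_id qone qmul.
Proof. by elim/quotP=> f; rewrite -pi_qmul mulr1. Qed.

Fact qmulDl : left_distributive qmul +%R.
Proof.
by do 3![elim/quotP=> ?]; rewrite -!(piD, pi_qmul) mulrDl.
Qed.

Fact qmulDr : right_distributive qmul +%R.
Proof.
by do 3![elim/quotP=> ?]; rewrite -!(piD, pi_qmul) mulrDr.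
Qed.

Fact qone_neq0 : qone != 0.
Proof.
apply/negP => /eqP; rewrite -[0](raddf0 \pi_alg_quot).
by move/pi_quot_eq; rewrite subr0 => /asboolP/S_proper.
Qed.

HB.instance Definition _ := GRing.Zmodule_isNzRing.Build alg_quot
  qmulA qmul1r qmulr1 qmulDl qmulDr qone_neq0.

Fact qscaleA c d a : qscale c (qscale d a) = qscale (c * d) a.
Proof. by elim/quotP: a => f; rewrite -!pi_qscale scalerA. Qed.

Fact qscale1 : left_id 1 qscale.
Proof. by elim/quotP=> f; rewrite -pi_qscale scale1r. Qed.

Fact qscaleDr : right_distributive qscale +%R.
Proof.
by move=> c; do 2![elim/quotP=> ?]; rewrite -!(piD, pi_qscale) scalerDr.
Qed.

Fact qscaleDl a : {morph qscale^~ a : c d / c + d}.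
Proof. by elim/quotP: a => f c d; rewrite -!pi_qscale -piD scalerDl. Qed.

HB.instance Definition _ := GRing.Zmodule_isLmodule.Build F alg_quot
  qscaleA qscale1 qscaleDr qscaleDl.

Fact qscaleAl (c : F) (a b : alg_quot) : c *: (a * b) = (c *: a) * b.
Proof.
elim/quotP: a => f; elim/quotP: b => g.
by rewrite -[LHS]/(qscale c (qmul _ _)) -[RHS]/(qmul (qscale _ _) _)
  -!(pi_qmul, pi_qscale) scalerAl.
Qed.

HB.instance Definition _ := GRing.Lmodule_isLalgebra.Build F alg_quot qscaleAl.

Fact qscaleAr (c : F) (a b : alg_quot) : c *: (a * b) = a * (c *: b).
Proof.
elim/quotP: a => f; elim/quotP: b => g.
by rewrite -[LHS]/(qscale c (qmul _ _)) -[RHS]/(qmul _ (qscale _ _))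
  -!(pi_qmul, pi_qscale) scalerAr.
Qed.

HB.instance Definition _ := GRing.Lalgebra_isAlgebra.Build F alg_quot qscaleAr.

Definition alg_pi (f : A) : alg_quot := \pi f.

Fact alg_pi_is_linear : linear alg_pi.
Proof. by move=> c f g; rewrite /alg_pi piD pi_qscale. Qed.

HB.instance Definition _ :=
  GRing.isLinear.Build F A alg_quot _ alg_pi alg_pi_is_linear.

Fact alg_pi_is_monoid_morphism : monoid_morphism alg_pi.
Proof. by split=> // f g; apply: pi_qmul. Qed.

HB.instance Definition _ :=
  GRing.isMonoidMorphism.Build A alg_quot alg_pi
    alg_pi_is_monoid_morphism.

Fact alg_pi_eq0 f : alg_pi f = 0 <-> ideal_gen S f.
Proof.
rewrite -(raddf0 alg_pi); split=> [/pi_quot_eq|If]; last apply/pi_quot_eq.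
  by rewrite subr0 => /asboolP.
by rewrite subr0; apply/asboolP.
Qed.

End AlgebraQuotient.

Definition free_alg (F : fieldType) (I : choiceType) := {malg F[{fmonom I}]}.

HB.instance Definition _ (F : fieldType) (I : choiceType) :=
  GRing.Lalgebra.on (free_alg F I).

Fact free_alg_scalerAr (F : fieldType) (I : choiceType) (c : F)
    (f g : {malg F[{fmonom I}]}) :
  c *: (f * g) = f * (c *: g).
Proof.
apply/malgP => k; rewrite mcoeffZ.
rewrite mcoeffMl (mcoeffMlw _ (fsubset_refl _) (msuppZ_le _ _)) mulr_sumr.
apply: eq_bigr => k1 _; rewrite mulr_sumr; apply: eq_bigr => k2 _.
by rewrite mcoeffZ mulrnAr mulrCA.
Qed.

HB.instance Definition _ (F : fieldType) (I : choiceType) :=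
  GRing.Lalgebra_isAlgebra.Build F (free_alg F I) (@free_alg_scalerAr F I).

Definition letter (F : fieldType) (I : choiceType) (i : I) : free_alg F I :=
  << fmu i >>.

Arguments letter F {I} i.

(* f(v_i : i in I), the image of f under the algebra morphism x_i |-> v_i. *)
Definition free_eval (F : fieldType) (I : choiceType) (A : algType F) (v : I -> A)
    (f : free_alg F I) : A :=
  mmap (in_alg A) (fun w : {fmonom I} => \prod_(i <- w : seq I) v i) f.

Section Weyl.
Variable F : fieldType.

Local Notation X := (letter F false).
Local Notation Y := (letter F true).

(* [false] and [true] index the free generators x and y. *)
Definition weyl_relator : free_alg F bool := Y * X - X * Y - 1.

(* The action of x and y on F[t] as multiplication by t and d/dt shows that
   the ideal is proper, in any characteristic. *)
Let act1 (b : bool) (p : {poly F}) := if b then p^`() else 'X * p.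
Let actw (w : {fmonom bool}) (p : {poly F}) : {poly F} := foldr act1 p w.
Let act (f : free_alg F bool) p := \sum_(w <- msupp f) f@_w *: actw w p.

Let actw_linear w : linear (actw w).
Proof.
rewrite /actw; elim: (w : seq bool) => //= b s IH a p q.
by case: b; rewrite /= IH ?linearP //= mulrDr scalerAr.
Qed.

Let actEw (d : {fset {fmonom bool}}) f p : (msupp f `<=` d)%fset ->
  act f p = \sum_(w <- d) f@_w *: actw w p.
Proof.
move=> le; rewrite /act (big_fset_incl _ le) // => w _ /mcoeff_outdom ->.
by rewrite scale0r.
Qed.

Let actD f g p : act (f + g) p = act f p + act g p.
Proof.
pose d := (msupp f `|` msupp g)%fset.
rewrite !(@actEw d) ?fsubsetUl ?fsubsetUr ?msuppD_le //.
by rewrite -big_split; apply: eq_bigr => w _; rewrite mcoeffD scalerDl.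
Qed.

Let actZ c f p : act (c *: f) p = c *: act f p.
Proof.
rewrite (actEw _ (msuppZ_le _ _)) scaler_sumr.
by apply: eq_bigr => w _; rewrite mcoeffZ scalerA.
Qed.

Let act0 p : act 0 p = 0.
Proof. by rewrite -(scale0r 0) actZ scale0r. Qed.

Let act_sum J (r : seq J) (h : J -> free_alg F bool) p :
  act (\sum_(j <- r) h j) p = \sum_(j <- r) act (h j) p.
Proof. by apply: (big_morph (act^~ p)) => // f g; apply: actD. Qed.

Let actU c w p : act << c *g w >> p = c *: actw w p.
Proof. by rewrite (actEw _ msuppU_le) big_seq_fset1 mcoeffUU. Qed.

Let actM f g p : act (f * g) p = act f (act g p).
Proof.
rewrite malgME act_sum; apply: eq_bigr => w _; rewrite act_sum [act g p]/act.
pose L := GRing.isLinear.Build _ _ _ _ (actw w) (@actw_linear w).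
pose h : {linear {poly F} -> {poly F}} := HB.pack (actw w) L.
rewrite -[actw w _]/(h _) linear_sum scaler_sumr; apply: eq_bigr => u _.
by rewrite actU linearZ scalerA /= /actw fmM foldr_cat.
Qed.

Let actN f p : act (- f) p = - act f p.
Proof. by rewrite -[- f]scaleN1r actZ scaleN1r. Qed.

Let act1E p : act 1 p = p.
Proof. by rewrite -mpolyC1E actU scale1r /actw fm1. Qed.

Let act_rel p : act weyl_relator p = 0.
Proof.
rewrite /weyl_relator !(actD, actN, actM) act1E /letter !actU /actw !fmU /=.
by rewrite !scale1r derivM derivX mul1r addrK subrr.
Qed.

Fact weyl_proper : ~ ideal_gen [set weyl_relator] 1.
Proof.
move=> [s [Ss E1]].
have := oner_eq0 {poly F}.
suff -> : 1 = 0 :> {poly F} by rewrite eqxx.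
rewrite -[1 in LHS]act1E E1 act_sum big_seq big1 // => t /Ss[a [r [b [-> ->]]]].
rewrite actZ !actM act_rel; suff -> : act a 0 = 0 by rewrite scaler0.
rewrite /act big1 // => w _.
have := actw_linear w (-1) 0 0; rewrite scaler0 addr0 scaleN1r addNr => ->.
by rewrite scaler0.
Qed.

Definition weyl := alg_quot weyl_proper.

HB.instance Definition _ := GRing.Algebra.on weyl.

Definition weyl_x : weyl := alg_pi weyl_proper X.
Definition weyl_y : weyl := alg_pi weyl_proper Y.

Fact weyl_rel : weyl_y * weyl_x - weyl_x * weyl_y = 1.
Proof.
apply/eqP; rewrite -subr_eq0 -(rmorph1 (alg_pi weyl_proper)) -!rmorphM -!rmorphB.
apply/eqP/alg_pi_eq0; exists [:: (1, weyl_relator)].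
rewrite big_seq1 scale1r; split=> // t; rewrite inE => /eqP ->.
by exists 1, weyl_relator, 1; rewrite mul1r mulr1.
Qed.

Definition weyl_V : set weyl := lspan [set weyl_x; weyl_y].

End Weyl.

Arguments weyl_x F : clear implicits.
Arguments weyl_y F : clear implicits.
Arguments weyl_V F : clear implicits.

Definition weak_identity (F : fieldType) (A : algType F) (V : set A)
    (f : free_alg F nat) : Prop :=
  forall v : nat -> A, (forall i, V (v i)) -> free_eval v f = 0.

Section Identities.
Variable R : pzRingType.
Implicit Types a b c d : R.

Definition lie a b := a * b - b * a.

Definition Gamma3 a b c := lie (lie a b) c.

Definition St3 a b c := a * lie b c - b * lie a c + c * lie a b.

Definition T4 a b c d :=
  lie a b * lie c d - lie a c * lie b d + lie b c * lie a d.

End Identities.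

Section LIdeal.
Variable F : fieldType.

(* The generators x_1, x_2, ... are the letters indexed by 0, 1, ... *)
Local Notation "'x_ i" := (letter F i%N) (at level 8, i at level 2).

Definition letter_span : set (free_alg F nat) := lspan (range (letter F)).

Definition L_ideal (S : set (free_alg F nat)) : set (free_alg F nat) :=
  ideal_gen [set h | exists p (g : nat -> free_alg F nat),
    [/\ S p, forall i, letter_span (g i) & h = free_eval g p]].

Definition weyl_L_ideal : set (free_alg F nat) :=
  L_ideal [set St3 'x_0 'x_1 'x_2; Gamma3 'x_0 'x_1 'x_2;
               T4 'x_0 'x_1 'x_2 'x_3].

End LIdeal.

(* Main.v *)
Require Import Defs.
From HB Require Import structures.
From mathcomp Require Import all_boot all_algebra.
From mathcomp Require Import boolp classical_sets cardinality.
From mathcomp Require Import finmap monalg ring.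

Set Implicit Arguments.
Unset Strict Implicit.
Unset Printing Implicit Defensive.

Import GRing.Theory.

Local Open Scope classical_set_scope.

(** Write a = x_1, b = x_2 and c = [a, b].  Modulo the ideal, c commutes with a
    and b, because the ideal contains [[a, b], a] and [[a, b], b].  So every
    element of F<a, b> is congruent to a linear combination of the ordered
    monomials b^i a^j c^k, and everything reduces to showing that the
    coefficients of this combination vanish when f is a weak identity.

    The reordering uses only the two commutation rules of c.  Hence the same
    coefficients express f(v) in every algebra, for every pair v whose
    commutator is central in the subalgebra that it generates
    ([normal_ordering]).  For each scalar t, this applies in the Weyl algebra
    to a = t y, b = x, whose commutator is t.  There f(v) = 0 reads
      sum of coef(i, j, k) t^(j + k) x^i y^j = 0.
    The monomials x^i y^j are linearly independent ([weyl_monomials_free]), so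
    for fixed i, j the polynomial in t with coefficient coef(i, j, k) at
    t^(j + k) has every scalar as a root.  As F is infinite it is zero, and all
    coef(i, j, k) vanish ([weak_identity_normal_coef]).  The normal form, read
    this time in the quotient of the free algebra by the ideal, gives f = 0
    there.

    The independence of the x^i y^j has to hold in every characteristic.  In
    characteristic p the action of x and y on F[t] by t and d/dt is not
    faithful, since (d/dt)^p = 0.  On F[s][t] the operators t and d/dt + s
    satisfy the same relation, and x^i y^j sends 1 to t^i s^j. *)

(** * Evaluation as an algebra morphism *)

Section FreeEval.
Local Open Scope ring_scope.
Variables (F : fieldType) (I : choiceType) (A : algType F) (v : I -> A).

Let word_val (w : {fmonom I}) : A := \prod_(i <- w : seq I) v i.

Fact word_val_mmorphism : mmorphism word_val.
Proof.
by split=> [u w|]; rewrite /word_val ?fmM ?fm1 ?big_cat ?big_nil.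
Qed.

Fact free_eval_is_zmod_morphism : zmod_morphism (free_eval v).
Proof. exact: (@mmap_is_additive _ _ _ (in_alg A) word_val). Qed.

Fact free_eval_is_monoid_morphism : monoid_morphism (free_eval v).
Proof.
pose h : {mmorphism {fmonom I} -> A} :=
  HB.pack word_val (isMultiplicative.Build _ _ word_val word_val_mmorphism).
have fM1 : multiplicative (mmap (in_alg A) h).
  apply: commr_mmap_is_multiplicative => g m m'.
  by rewrite /GRing.comm /= mulr_algl mulr_algr.
by split=> [|f g]; [apply: fM1.2 | apply: fM1.1].
Qed.

HB.instance Definition _ :=
  GRing.isZmodMorphism.Build (free_alg F I) A (free_eval v)
    free_eval_is_zmod_morphism.
HB.instance Definition _ :=
  GRing.isMonoidMorphism.Build (free_alg F I) A (free_eval v)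
    free_eval_is_monoid_morphism.

Fact free_eval_is_scalable : scalable (free_eval v).
Proof.
move=> c f; rewrite -mul_malgC rmorphM /=.
by rewrite /free_eval mmapU /= fm1 big_nil mulr1 mulr_algl.
Qed.

HB.instance Definition _ :=
  GRing.isScalable.Build F (free_alg F I) A _ (free_eval v)
    free_eval_is_scalable.

Lemma free_eval_letter i : free_eval v (letter F i) = v i.
Proof. by rewrite /free_eval mmapU /= fmU big_seq1 scale1r mul1r. Qed.

End FreeEval.

Lemma free_eval_morph (F : fieldType) (I : choiceType) (A : algType F)
    (S : set (free_alg F I)) (phi : {lrmorphism free_alg F I -> A}) f :
  S `<=` range (letter F) -> subalg_gen S f ->
  free_eval (fun i => phi (letter F i)) f = phi f.
Proof.
move=> SX; elim=> {f} [f /SX[i _ <-]||f g _ IHf _ IHg|c f _ IHf|f g _ IHf _ IHg].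
- exact: free_eval_letter.
- by rewrite !rmorph1.
- by rewrite !raddfD /= IHf IHg.
- by rewrite !linearZ /= IHf.
- by rewrite !rmorphM /= IHf IHg.
Qed.

(** * Normal ordering *)

Section NormalOrdering.
Local Open Scope ring_scope.
Variable F : fieldType.

(** The triple ((i, j), k) stands for b^i a^j c^k, where a, b are the values of
    the letters 0, 1 and c = [a, b]. *)
Definition ordered_monomial (A : algType F) (v : nat -> A)
    (e : nat * nat * nat) : A :=
  v 1%N ^+ e.1.1 * v 0%N ^+ e.1.2 * lie (v 0%N) (v 1%N) ^+ e.2.

(** Under this condition the values of the letters 0 and 1 define a
    representation of the Heisenberg Lie algebra. *)
Definition heisenberg (A : algType F) (v : nat -> A) :=
  Gamma3 (v 0%N) (v 1%N) (v 0%N) = 0 /\ Gamma3 (v 0%N) (v 1%N) (v 1%N) = 0.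

(** The quantification over all algebras lets one list of coefficients serve
    both for the Weyl algebra, where the coefficients are determined, and for
    the quotient by the ideal, where the conclusion is drawn.  Exponents may be
    repeated in [s]: only the total coefficient of each of them matters. *)
Definition normal_form (f : free_alg F nat) (s : seq (F * (nat * nat * nat))) :=
  forall (A : algType F) (v : nat -> A), heisenberg v ->
    free_eval v f = \sum_(t <- s) t.1 *: ordered_monomial v t.2.

Definition normally_ordered (f : free_alg F nat) := exists s, normal_form f s.

(** The Leibniz rule for the derivation [a, -], which sends b to an element
    commuting with b.  At n = 0 the coefficient n kills the junk term. *)
Lemma heisenberg_mulXn (A : algType F) (a b : A) n :
  Gamma3 a b b = 0 ->
  a * b ^+ n = b ^+ n * a + n%:R *: (b ^+ n.-1 * lie a b).
Proof.
move=> /subr0_eq cb.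
have cbn k : GRing.comm (lie a b) (b ^+ k) by apply: commrX.
elim: n => [|n IH]; first by rewrite expr0 mulr1 mul1r scale0r addr0.
have ab : a * b = b * a + lie a b by rewrite /lie addrC subrK.
rewrite exprS mulrA ab mulrDl -mulrA IH mulrDr mulrA -exprS -addrA.
congr (_ + _).
rewrite cbn -scalerAr mulrA.
case: n {IH} => [|n]; first by rewrite !scale0r scale1r add0r.
by rewrite -exprS /= -[in RHS]natr1 scalerDl scale1r.
Qed.

Lemma normally_ordered1 : normally_ordered 1.
Proof.
exists [:: (1, (0, 0, 0)%N)] => A v _.
by rewrite big_seq1 rmorph1 /ordered_monomial !expr0 !mulr1 scale1r.
Qed.

Lemma normally_orderedD f g :
  normally_ordered f -> normally_ordered g -> normally_ordered (f + g).
Proof.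
move=> [s Es] [t Et]; exists (s ++ t) => A v Hv.
by rewrite big_cat /= raddfD /= Es // Et.
Qed.

Lemma normally_orderedZ c f : normally_ordered f -> normally_ordered (c *: f).
Proof.
move=> [s Es]; exists [seq (c * t.1, t.2) | t <- s] => A v Hv.
rewrite big_map linearZ /= Es // scaler_sumr.
by apply: eq_bigr => t _; rewrite scalerA.
Qed.

(** a b^i a^j c^k = b^i a^(j+1) c^k + i b^(i-1) a^j c^(k+1). *)
Lemma normally_ordered_letter0 f :
  normally_ordered f -> normally_ordered (letter F 0%N * f).
Proof.
move=> [s Es].
exists ([seq (t.1, (t.2.1.1, t.2.1.2.+1, t.2.2)) | t <- s] ++
        [seq (t.1 * t.2.1.1%:R, (t.2.1.1.-1, t.2.1.2, t.2.2.+1)) | t <- s]).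
move=> A v Hv; rewrite rmorphM /= free_eval_letter Es // big_cat !big_map /=.
rewrite -big_split mulr_sumr; apply: eq_bigr => -[c [[i j] k]] _ /=.
case: Hv => Ha Hb; rewrite /ordered_monomial /= -scalerAr -scalerA -scalerDr.
congr (_ *: _); rewrite !mulrA (@heisenberg_mulXn _ (v 0%N) (v 1%N)) //.
rewrite !mulrDl -!scalerAl.
rewrite exprS !mulrA; congr (_ + _ *: _).
rewrite [in RHS]exprS !mulrA; congr (_ * _); rewrite -!mulrA; congr (_ * _).
by apply: commrX; apply: subr0_eq.
Qed.

Lemma normally_ordered_letter1 f :
  normally_ordered f -> normally_ordered (letter F 1%N * f).
Proof.
move=> [s Es]; exists [seq (t.1, (t.2.1.1.+1, t.2.1.2, t.2.2)) | t <- s].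
move=> A v Hv; rewrite rmorphM /= free_eval_letter Es // big_map mulr_sumr.
apply: eq_bigr => t _.
by rewrite /ordered_monomial /= -scalerAr exprS !mulrA.
Qed.

(** Normally ordered elements are stable under left multiplication by the two
    letters, hence by the whole subalgebra; they contain 1. *)
Lemma normal_ordering f :
  subalg_gen [set letter F 0%N; letter F 1%N] f -> normally_ordered f.
Proof.
(* Generalizing the right factor 1 makes the induction hypothesis apply to the
   two factors of a product in turn. *)
move=> Hf; rewrite -[f]mulr1; move: normally_ordered1.
elim: Hf (1 : free_alg F nat) => {f} [f [->|->]||f g _ IHf _ IHg|c f _ IHf
  |f g _ IHf _ IHg] h Nh.
- exact: normally_ordered_letter0.
- exact: normally_ordered_letter1.
- by rewrite mul1r.
- by rewrite mulrDl; apply: normally_orderedD; [apply: IHf | apply: IHg].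
- by rewrite -scalerAl; apply/normally_orderedZ/IHf.
- by rewrite -mulrA; apply/IHf/IHg.
Qed.

End NormalOrdering.

(** * Linear independence of the monomials of the Weyl algebra *)

Lemma lrmorph_ordered_sum (F : fieldType) (A B : algType F)
    (phi : {lrmorphism A -> B}) (a b : A) (s : seq (F * (nat * nat))) :
  (phi (\sum_(t <- s) t.1 *: (a ^+ t.2.1 * b ^+ t.2.2)) =
    \sum_(t <- s) t.1 *: (phi a ^+ t.2.1 * phi b ^+ t.2.2))%R.
Proof.
rewrite linear_sum; apply: eq_bigr => t _.
by rewrite linearZ /= rmorphM !rmorphXn.
Qed.

Section WeylMonomials.
Local Open Scope ring_scope.
Variable F : fieldType.
Local Notation S := {poly {poly F}}.
Local Notation cst := (polyC \o polyC : F -> S).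

(** The inner variable is s and the outer one t, so that both operators, x = t
    and y = d/dt + s, are linear over F[s]. *)
Definition weyl_op (b : bool) (p : S) : S :=
  if b then p^`() + 'X%:P * p else 'X * p.

Definition word_op (w : {fmonom bool}) (p : S) : S := foldr weyl_op p w.

(** The operator of [f] applied to [p], with [f] as the last argument since
    additivity in [f] then comes from that of [mmap]. *)
Definition weyl_act (p : S) (f : free_alg F bool) : S :=
  mmap cst (word_op^~ p) f.

Fact weyl_act_is_zmod_morphism p : zmod_morphism (weyl_act p).
Proof. exact: mmap_is_additive. Qed.

HB.instance Definition _ p :=
  GRing.isZmodMorphism.Build (free_alg F bool) S (weyl_act p)
    (weyl_act_is_zmod_morphism p).

Fact word_op_is_linear w : linear (word_op w).
Proof.
rewrite /word_op => c p q; elim: (w : seq bool) => //= b s ->.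
case: b => /=; last by rewrite mulrDr scalerAr.
by rewrite linearP mulrDr scalerDr scalerAr addrACA.
Qed.

HB.instance Definition _ w :=
  GRing.isLinear.Build {poly F} S S _ (word_op w) (word_op_is_linear w).

Lemma weyl_actM p f g : weyl_act p (f * g) = weyl_act (weyl_act p g) f.
Proof.
rewrite malgME raddf_sum; apply: eq_bigr => u _; rewrite raddf_sum /=.
rewrite [weyl_act p g]/weyl_act mmapE linear_sum mulr_sumr.
apply: eq_bigr => w _; rewrite [LHS]mmapU [RHS]/=.
by rewrite !mul_polyC linearZ /= scalerA -rmorphM /word_op fmM foldr_cat.
Qed.

Lemma weyl_act_letter p b : weyl_act p (letter F b) = weyl_op b p.
Proof. by rewrite [LHS]mmapU /= !polyC1 mul1r /word_op fmU. Qed.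

Lemma weyl_act1 p : weyl_act p 1 = p.
Proof. by rewrite -mpolyC1E [LHS]mmapU /= !polyC1 mul1r /word_op fm1. Qed.

Lemma weyl_actZ p c f : weyl_act p (c *: f) = cst c * weyl_act p f.
Proof.
by rewrite -mul_malgC weyl_actM [LHS]mmapU /word_op fm1.
Qed.

Lemma weyl_act_relator p : weyl_act p (weyl_relator F) = 0.
Proof.
have actB f g : weyl_act p (f - g) = weyl_act p f - weyl_act p g.
  exact: raddfB.
have -> : weyl_act p (weyl_relator F) =
    weyl_op true (weyl_op false p) - weyl_op false (weyl_op true p) - p.
  apply: (etrans (actB _ _)); apply: f_equal2; last by rewrite weyl_act1.
  by apply: (etrans (actB _ _)); apply: f_equal2;
    rewrite weyl_actM !weyl_act_letter.
by rewrite /weyl_op derivM derivX; ring.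
Qed.

Lemma word_op0 w : word_op w (0 : S) = 0.
Proof.
rewrite /word_op; elim: (w : seq bool) => //= b s ->.
by case: b; rewrite /weyl_op ?raddf0 !mulr0 ?addr0.
Qed.

(** The action factors through the Weyl algebra. *)
Lemma weyl_act_eq0 p f : alg_pi (@weyl_proper F) f = 0 -> weyl_act p f = 0.
Proof.
move=> /alg_pi_eq0[s [Ss ->]]; rewrite raddf_sum /= big_seq big1 // => t /Ss.
move=> [a [r [b [-> ->]]]].
rewrite weyl_actZ !weyl_actM weyl_act_relator.
have -> : weyl_act 0 a = 0.
  by rewrite [LHS]mmapE big1 // => w _; rewrite word_op0 mulr0.
exact: mulr0.
Qed.

Lemma weyl_act_monomial i j :
  weyl_act 1 (letter F false ^+ i * letter F true ^+ j) = 'X^i * 'X%:P ^+ j.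
Proof.
elim: i => [|i IH]; last first.
  by rewrite exprS -mulrA weyl_actM IH weyl_act_letter /= exprS mulrA.
rewrite !expr0 !mul1r; elim: j => [|j IH]; first by rewrite !expr0 weyl_act1.
(* y^j acts on constants in t, where d/dt vanishes. *)
rewrite exprS weyl_actM IH weyl_act_letter /= -rmorphXn derivC add0r.
by rewrite rmorphXn exprS.
Qed.

(** Applying the action to 1 turns a relation between the x^i y^j into the same
    relation between the bivariate monomials t^i s^j. *)
Lemma weyl_monomials_free (s : seq (F * (nat * nat))) :
  \sum_(t <- s) t.1 *: (weyl_x F ^+ t.2.1 * weyl_y F ^+ t.2.2) = 0 ->
  forall e, \sum_(t <- s | t.2 == e) t.1 = 0.
Proof.
move=> s0 [i j].
have s1 : weyl_act 1 (\sum_(t <- s)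
    t.1 *: (letter F false ^+ t.2.1 * letter F true ^+ t.2.2)) = 0.
  by apply: weyl_act_eq0; rewrite lrmorph_ordered_sum.
have := congr1 (fun p : S => p`_i`_j) s1.
rewrite raddf_sum !coef0 !coef_sum => sij; rewrite -[RHS]sij big_mkcond.
apply: eq_bigr => -[c [i' j']] _ /=.
rewrite weyl_actZ weyl_act_monomial /= -rmorphXn /= coefCM coefMC.
rewrite coefXn xpair_eqE.
rewrite ![_ == i]eq_sym ![_ == j]eq_sym.
rewrite coefCM mulr_natl coefMn coefXn.
by case: (i == i'); case: (j == j'); rewrite /= ?mulr0 ?mulr1.
Qed.

End WeylMonomials.

(** * Coefficients of a weak identity *)

Lemma lspan_sub (F : fieldType) (A : algType F) (S : set A) : S `<=` lspan S.
Proof.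
move=> a Sa; exists [:: (1%R, a)]; rewrite big_seq1 scale1r; split=> // t.
by rewrite inE => /eqP ->.
Qed.

Section Independence.
Local Open Scope ring_scope.
Variable F : fieldType.

Lemma poly_eq0_infinite (P : {poly F}) :
  infinite_set [set: F] -> (forall a, P.[a] = 0) -> P = 0.
Proof.
move=> /(@infinite_set_fset _ _ (size P))[B _ leB] P0.
apply: (@roots_geq_poly_eq0 _ P B) leB => //; last exact: fset_uniq.
by apply/allP => a _; apply/rootP.
Qed.

(** The central element [c y, x] equals the scalar c, so each factor of the
    central element and each factor y contributes one power of c. *)
Lemma heisenberg_scaled_pair (A : algType F) (x y : A) (c : F)
    (v : nat -> A) :
  lie y x = 1 -> v 0%N = c *: y -> v 1%N = x ->
  heisenberg v /\
  forall e, ordered_monomial v e =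
    c ^+ (e.1.2 + e.2) *: (x ^+ e.1.1 * y ^+ e.1.2).
Proof.
move=> yx v0 v1.
have lv : lie (v 0%N) (v 1%N) = c%:A.
  by rewrite v0 v1 /lie -scalerAl -scalerAr -scalerBr -[_ - _]/(lie y x) yx.
split=> [|e].
  by split; rewrite /Gamma3 lv /lie mulr_algl mulr_algr subrr.
rewrite /ordered_monomial lv v0 v1 !exprZn expr1n.
by rewrite -!(scalerAl, scalerAr) mulr1 scalerA exprD mulrC.
Qed.

(** Substituting c y and x, for a varying scalar c, separates the exponents: x
    and y give i and j by independence of the monomials, and the powers c^(j+k)
    then give k because F is infinite. *)
Lemma weak_identity_normal_coef (s : seq (F * (nat * nat * nat)))
    (f : free_alg F nat) :
  infinite_set [set: F] -> weak_identity (weyl_V F) f -> normal_form f s ->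
  forall e, \sum_(t <- s | t.2 == e) t.1 = 0.
Proof.
move=> Finf f0 Ef [[i j] k].
pose P : {poly F} := \sum_(t <- s | t.2.1 == (i, j)) t.1 *: 'X^(t.2.1.2 + t.2.2).
have P0 : P = 0.
  apply: poly_eq0_infinite => // c.
  pose v n : weyl F :=
    if n is m.+1 then if m is 0%N then weyl_x F else 0 else c *: weyl_y F.
  have [Hv Ev] : heisenberg v /\ _ :=
    heisenberg_scaled_pair (@weyl_rel F) erefl erefl.
  have Vv n : weyl_V F (v n).
    case: n => [|[|n]]; last exact: lspan0; last by apply: lspan_sub; left.
    by apply/lspanZ/lspan_sub; right.
  have := f0 v Vv; rewrite Ef // => s0.
  have := @weyl_monomials_free F
    [seq (t.1 * c ^+ (t.2.1.2 + t.2.2), t.2.1) | t <- s] _ (i, j).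
  rewrite !big_map => sij; rewrite -[RHS]sij; last first.
    by rewrite -[RHS]s0; apply: eq_bigr => t _; rewrite Ev scalerA.
  by rewrite horner_sum; apply: eq_bigr => t _; rewrite hornerZ hornerXn.
have := congr1 (fun p : {poly F} => p`_(j + k)) P0.
rewrite coef0 coef_sum => Pjk; rewrite -[RHS]Pjk big_mkcond [RHS]big_mkcond.
apply: eq_bigr => -[c [[i' j'] k']] _ /=.
rewrite coefZ coefXn !xpair_eqE.
case: (i' == i) => //=; case: eqP => //= ->.
by rewrite eqn_add2l eq_sym; case: eqP => _; rewrite ?mulr1 ?mulr0.
Qed.

Lemma sum_by_exponent (E : eqType) (A : lmodType F) (m : E -> A)
    (s : seq (F * E)) :
  (forall e, \sum_(t <- s | t.2 == e) t.1 = 0) ->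
  \sum_(t <- s) t.1 *: m t.2 = 0.
Proof.
move=> s0.
transitivity (\sum_(t <- s) \sum_(e <- undup (unzip2 s))
    if t.2 == e then t.1 *: m e else 0).
  apply: eq_big_seq => t ts.
  rewrite (bigD1_seq t.2) ?undup_uniq ?mem_undup ?map_f //= eqxx.
  by rewrite big1 ?addr0 // => e /negPf; rewrite eq_sym => ->.
rewrite exchange_big big1 // => e _ /=.
by rewrite -big_mkcond -scaler_suml s0 scale0r.
Qed.

End Independence.

(** * The commutator relations in the ideal *)

Lemma rmorph_Gamma3 (A B : pzRingType) (phi : {rmorphism A -> B}) a b c :
  phi (Gamma3 a b c) = Gamma3 (phi a) (phi b) (phi c).
Proof. by rewrite /Gamma3 /lie !(rmorphB, rmorphM). Qed.

Lemma Gamma3_in_weyl_L_ideal (F : fieldType) (i j k : nat) :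
  weyl_L_ideal (Gamma3 (letter F i) (letter F j) (letter F k)).
Proof.
apply: lspan_sub; exists 1%R, (Gamma3 (letter F i) (letter F j) (letter F k)), 1%R.
split; last by rewrite mul1r mulr1.
exists (Gamma3 (letter F 0%N) (letter F 1%N) (letter F 2%N)).
exists (fun n => letter F (if n is m.+1 then if m is 0%N then j else k else i)).
split; [by left; right | by move=> n; apply/lspan_sub/imageT |].
by rewrite rmorph_Gamma3 /= !free_eval_letter.
Qed.

(** * From the normal form to membership in the ideal *)

Theorem theorem6p1 (F : fieldType) (F_infinite : infinite_set [set: F])
    (f : free_alg F nat) (f_x1x2 : subalg_gen [set letter F 0%N; letter F 1%N] f)
    (f_weak : weak_identity (weyl_V F) f) :
  weyl_L_ideal f.
Proof.
have [s Ef] := normal_ordering f_x1x2.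
have s0 := weak_identity_normal_coef F_infinite f_weak Ef.
rewrite /weyl_L_ideal /L_ideal; set G := (X in ideal_gen X).
(* The quotient algebra exists only for a proper ideal. *)
have [G1|Gproper] := pselect (ideal_gen G (1 : free_alg F nat)%R).
  by rewrite -[f]mulr1; apply: ideal_genMl.
apply/(alg_pi_eq0 Gproper).
(* In the quotient, f is its own evaluation at the classes of the letters. *)
rewrite -(free_eval_morph (alg_pi Gproper) _ f_x1x2); last first.
  by move=> _ [->|->]; apply: imageT.
rewrite Ef; first exact: sum_by_exponent.
by split; rewrite -rmorph_Gamma3; apply/alg_pi_eq0/Gamma3_in_weyl_L_ideal.
Qed.
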